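(* Let $q\in\mathbb N_1$, $\theta>0$, let $\nu$ be a Borel probability measure on $\Delta^{q-1}$, let $\mathbf n\in\mathbb N_0^q$ and $n=|\mathbf n|$. For all $\mathbf t=(t_{\mathbf a})_{\mathbf a\le\mathbf n}$, $$\sum_{A\vDash\mathbf n}\mathscr E^n_{\theta,\nu}[A]\,\mathbf t^A=\frac{n!}{\langle\theta\rangle_n}\binom n{\mathbf n}\,Z^{(q)}_{\mathbf n}\big((\theta\,m_{\mathbf a}(\nu)\,t_{\mathbf a})_{\mathbf a\le\mathbf n}\big),$$ and therefore summing over the colorings $\mathbf n\in\mathbb N^q_0$ with $|\mathbf n|=n$ gives the generating function $\sum_{A\in\mathcal A^{(q)}_n}\mathscr E^n_{\theta,\nu}[A]\,\mathbf t^A$ of $\mathscr E^n_{\theta,\nu}$.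
   Context: Notation: $\mathbb N_1=\{1,2,\dots\}$, $\mathbb N_0=\{0,1,\dots\}$, $\mathbb N^q_*=\mathbb N_0^q\setminus\{\mathbf 0\}$, $0^0=1$; $|\mathbf a|=\sum_ja_j$, $\mathbf n!=\prod_jn_j!$, $\mathbf u^{\mathbf a}=\prod_ju_j^{a_j}$, $\binom{|\mathbf a|}{\mathbf a}=|\mathbf a|!/\mathbf a!$; $\mathbf a\le\mathbf n$ is coordinatewise; $\Delta^{q-1}=\{\mathbf u\in[0,1]^q:|\mathbf u|=1\}$; $\langle\theta\rangle_n=\theta(\theta+1)\cdots(\theta+n-1)$; $m_{\mathbf a}(\nu)=\int_{\Delta^{q-1}}\mathbf u^{\mathbf a}\,d\nu(\mathbf u)$. A $q$-chromatic partition of $n$ is a finitely supported map $A\colon\mathbb N^q_*\to\mathbb N_0$ with $\sum_{\mathbf a}A(\mathbf a)|\mathbf a|=n$; $\mathcal A^{(q)}_n$ is the set of these. Write $A\vDash\mathbf n$ if $\sum_{\mathbf a}A(\mathbf a)\,\mathbf a=\mathbf n$. $\mathbf t^A=\prod_{\mathbf a\in\mathrm{supp}A}t_{\mathbf a}^{A(\mathbf a)}$. Multinomial coefficient of $A\vDash\mathbf n$: $M(A)=\mathbf n!\prod_{\mathbf a\in\mathrm{supp}A}\frac{\binom{|\mathbf a|}{\mathbf a}^{A(\mathbf a)}}{|\mathbf a|^{A(\mathbf a)}A(\mathbf a)!}$. The $q$-chromatic cycle index polynomial is $Z^{(q)}_{\mathbf n}(\mathbf t)=\frac1{|\mathbf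 n|!}\sum_{A\vDash\mathbf n}M(A)\,\mathbf t^A$, $Z^{(q)}_{\mathbf 0}=1$. Polychromatic Ewens Sampling Formula: $$\mathscr E^n_{\theta,\nu}[A]=\frac{n!}{\langle\theta\rangle_n}\prod_{\mathbf a\in\mathrm{supp}A}\frac1{A(\mathbf a)!}\Big(\frac{\theta}{|\mathbf a|}\binom{|\mathbf a|}{\mathbf a}m_{\mathbf a}(\nu)\Big)^{A(\mathbf a)},\qquad A\in\mathcal A^{(q)}_n.$$ *)

(* Defs.v *)
From HB Require Import structures.
From mathcomp Require Import all_boot all_order all_algebra finmap.
From mathcomp Require Import all_classical all_reals all_analysis.

Set Implicit Arguments.
Unset Strict Implicit.
Unset Printing Implicit Defensive.

Import Order.TTheory GRing.Theory Num.Theory.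
Import numFieldNormedType.Exports.

Local Open Scope classical_set_scope.
Local Open Scope ring_scope.

Definition multi (q : nat) : Type := {ffun 'I_q -> nat}.
HB.instance Definition _ q := Choice.on (multi q).
HB.instance Definition _ q := GRing.Nmodule.on (multi q).

Definition multi_pos (q : nat) : Type := {a : multi q | a != 0}.
HB.instance Definition _ q := Choice.on (multi_pos q).

Definition mabs q (a : multi q) : nat := (\sum_j a j)%N.

Definition mfact q (a : multi q) : nat := (\prod_j (a j)`!)%N.

Definition multinomial (R : realType) q (a : multi q) : R :=
  (mabs a)`!%:R / (mfact a)%:R.

(* Finitely supported maps on the nonzero multi-indices; the size of the
   partition is imposed separately, by [chromatic_partitions]. *)
Definition chromatic (q : nat) : Type := {fsfun multi_pos q -> nat with 0%N}.
HB.instance Definition _ q := [Choice of chromatic q by <:].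

Definition chromatic_partitions q (n : nat) : set (chromatic q) :=
  [set A | (\sum_(a <- finsupp A) A a * mabs (val a))%N = n].

(* The A with A |= nn. Like [chromatic_partitions q n], this is a finite set
   (the multi-indices are nonzero), so sums over it are never cut down to 0 by
   the convention of [fsbigop] on infinite supports. *)
Definition partitions_of q (nn : multi q) : set (chromatic q) :=
  [set A | \sum_(a <- finsupp A) val a *+ A a = nn].

Definition monom (R : realType) q (t : multi_pos q -> R) (A : chromatic q) : R :=
  \prod_(a <- finsupp A) t a ^+ A a.

Definition multinomial_coef (R : realType) q (nn : multi q) (A : chromatic q) : R :=
  (mfact nn)%:R *
  \prod_(a <- finsupp A)
    (multinomial R (val a) ^+ A a /
     ((mabs (val a))%:R ^+ A a * (A a)`!%:R)).

(* Evaluation at t of the cycle index polynomial. A total family t is taken for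
   uniformity: only the t a with a <= nn coordinatewise occur. For nn = 0 the
   only partition is the empty one and the value is 1. *)
Definition cycle_index (R : realType) q (nn : multi q) (t : multi_pos q -> R) : R :=
  (mabs nn)`!%:R^-1 *
  \sum_(A \in partitions_of nn) multinomial_coef R nn A * monom t A.

Definition rising (R : realType) (theta : R) (n : nat) : R :=
  \prod_(i < n) (theta + i%:R).

Definition simplex_set (R : realType) (q : nat) : set 'rV[R]_q :=
  [set u | (forall j, 0 <= u ord0 j <= 1) /\ \sum_j u ord0 j = 1].

(* The standard simplex in R^q as a topological space of its own. Measurable
   types are pointed, hence the proof of 0 < q in the type. *)
Definition simplex (R : realType) (q : nat) (q_gt0 : (0 < q)%N) : Type :=
  set_type (@simplex_set R q).

Section simplex_instances.
Context (R : realType) (q : nat) (q_gt0 : (0 < q)%N).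

HB.instance Definition _ :=
  Topological.copy (simplex R q_gt0) (set_type (@simplex_set R q)).

Lemma simplex_vertex :
  delta_mx ord0 (Ordinal q_gt0) \in @simplex_set R q.
Proof.
rewrite inE; split=> [j|]; first by rewrite mxE /=; case: eqP; rewrite ?ler01 ?lexx.
rewrite (bigD1 (Ordinal q_gt0)) //= mxE !eqxx /= big1 ?addr0 // => j jN0.
by rewrite mxE (negPf jN0).
Qed.

HB.instance Definition _ :=
  isPointed.Build (simplex R q_gt0) (exist (fun u => u \in @simplex_set R q) _ simplex_vertex).

End simplex_instances.

Definition borel_simplex (R : realType) (q : nat) (q_gt0 : (0 < q)%N) :=
  g_sigma_algebraType (@open (simplex R q_gt0)).

Definition moment (R : realType) q (q_gt0 : (0 < q)%N)
    (nu : probability (borel_simplex R q_gt0) R) (a : multi q) : R :=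
  \int[nu]_u \prod_j (set_val u : 'rV[R]_q) ord0 j ^+ a j.

(* The probability of A under the polychromatic Ewens sampling formula; it is
   meant for A in [chromatic_partitions q n]. *)
Definition ESF (R : realType) q (q_gt0 : (0 < q)%N) (theta : R)
    (nu : probability (borel_simplex R q_gt0) R) (n : nat) (A : chromatic q) : R :=
  n`!%:R / rising theta n *
  \prod_(a <- finsupp A)
    ((A a)`!%:R^-1 *
     (theta / (mabs (val a))%:R * multinomial R (val a) * moment nu (val a))
       ^+ A a).

(* Main.v *)
Require Import Defs.
From mathcomp Require Import all_boot all_order all_algebra finmap.
From mathcomp Require Import all_classical all_reals all_analysis.
From mathcomp Require Import ring.

Import GRing.Theory Num.Theory.

Local Open Scope classical_set_scope.
Local Open Scope ring_scope.

(** The identity for a fixed coloring [nn] holds term by term. Both the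
    sampling formula and the coefficient [multinomial_coef] are products over
    the support of [A] built from the same factors, and [monom] is
    multiplicative, so that the powers [(theta * moment a) ^ A a] can be moved
    from the probability of [A] into the arguments of the cycle index. The
    factorials [nn!] and [|nn|!] which normalize the cycle index are cancelled
    by the multinomial coefficient of [nn]. This is [ESF_monom].

    The second identity follows by fibering: the total coloring
    [A |-> \sum_a A(a) a] maps the partitions of [n] to the colorings of total
    size [n], because [mabs] is additive, and its fiber over [nn] is
    [partitions_of nn]. Sums over infinite supports are 0 by convention, so the
    regrouping [fsbig_fibers] requires finiteness of both index sets. A color
    vector in the support of a partition of [n] has size at most [n] and
    multiplicity at most [n], because the color vectors are nonzero
    ([chromatic_partitions_bound]); this leaves finitely many possible
    functions. *)

(** * Regrouping finitely supported sums *)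

(** Exchanging the two sums on the right leaves, for each [x], a sum over [y]
    whose only nonzero term is at [y = f x]. *)
Lemma fsbig_fibers {R : nmodType} {X Y : choiceType} {A : set X} {B : set Y}
    (f : X -> Y) (F : X -> R) :
  finite_set A -> finite_set B -> f @` A `<=` B ->
  \sum_(x \in A) F x = \sum_(y \in B) \sum_(x \in A `&` f @^-1` [set y]) F x.
Proof.
move=> finA finB fAB.
under [RHS]eq_fsbigr do rewrite fsbig_mkcondr.
rewrite exchange_fsbig//; apply: eq_fsbigr => x; rewrite inE => Ax.
have Bfx : B (f x) by apply: fAB; exists x.
rewrite (fsbigD1 (f x))// ifT ?inE// fsbig1 ?Monoid.mulm1// => y [_ /= yfx].
by case: ifPn => //; rewrite inE /= => /esym.
Qed.

(** * Sizes of color vectors *)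

Lemma mabs0 q : mabs (0 : multi q) = 0%N.
Proof. by rewrite /mabs big1// => j _; rewrite ffunE. Qed.

Lemma mabsD q (a b : multi q) : mabs (a + b) = (mabs a + mabs b)%N.
Proof. by rewrite /mabs -big_split; apply: eq_bigr => j _; rewrite ffunE. Qed.

Lemma mabsMn q (a : multi q) k : mabs (a *+ k) = (k * mabs a)%N.
Proof.
by elim: k => [|k IHk]; rewrite ?mulr0n ?mabs0// GRing.mulrS mabsD IHk mulSn.
Qed.

Lemma leq_mabs q (a : multi q) j : (a j <= mabs a)%N.
Proof. by rewrite /mabs (bigD1 j)//= leq_addr. Qed.

Lemma mabs_gt0 q (a : multi_pos q) : (0 < mabs (val a))%N.
Proof.
rewrite lt0n; apply: contra (valP a); rewrite sum_nat_eq0 => /forallP a0.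
by apply/eqP/ffunP => j; rewrite [RHS]ffunE; apply/eqP/(implyP (a0 j)).
Qed.

Lemma mfact_gt0 q (a : multi q) : (0 < mfact a)%N.
Proof. by apply: prodn_gt0 => j; apply: fact_gt0. Qed.

(** The fibers of this map are the sets [partitions_of nn]. *)
Definition coloring q (A : chromatic q) : multi q :=
  \sum_(a <- finsupp A) val a *+ A a.

Lemma mabs_coloring q (A : chromatic q) :
  mabs (coloring q A) = (\sum_(a <- finsupp A) A a * mabs (val a))%N.
Proof.
rewrite /coloring (big_morph _ (@mabsD q) (@mabs0 q)).
by apply: eq_bigr => a _; rewrite mabsMn.
Qed.

(** * Finiteness of the index sets *)

Lemma finite_mabs_le q n : finite_set [set a : multi q | (mabs a <= n)%N].
Proof.
pose dec (g : {ffun 'I_q -> 'I_n.+1}) : multi q := [ffun j => val (g j)].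
apply: (@sub_finite_set _ _ (dec @` setT)).
  move=> a /= le_a; exists [ffun j => inord (a j)] => //.
  apply/ffunP => j; rewrite 2!ffunE /= inordK// ltnS.
  exact: leq_trans (leq_mabs _ _ _) le_a.
exact/finite_image/finite_finset.
Qed.

Lemma finite_mabs_eq q n : finite_set [set a : multi q | mabs a = n].
Proof. by apply: sub_finite_set (finite_mabs_le q n) => a /= ->. Qed.

Lemma finite_bounded_fsfun {K : choiceType} (S : {fset K}) n :
  finite_set [set A : {fsfun K -> nat with 0%N} |
    (finsupp A `<=` S)%fset /\ forall a, (A a <= n)%N].
Proof.
pose dec (g : {ffun S -> 'I_n.+1}) : {fsfun K -> nat with 0%N} :=
  [fsfun a : S => val (g a)].
apply: (@sub_finite_set _ _ (dec @` setT)).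
  move=> A /= [AS An]; exists [ffun a : S => inord (A (val a))] => //.
  apply/fsfunP => a; rewrite fsfun_ffun; case: insubP => [u uS <- /=|aS /=].
    by rewrite ffunE inordK// ltnS.
  by rewrite fsfun_dflt//; apply: contra aS => /(fsubsetP AS).
exact/finite_image/finite_finset.
Qed.

(** Each summand [A a * mabs a] is at most [n], and both factors are positive
    on the support. *)
Lemma chromatic_partitions_bound q n (A : chromatic q) (a : multi_pos q) :
  chromatic_partitions n A -> a \in finsupp A ->
  (A a <= n)%N /\ (mabs (val a) <= n)%N.
Proof.
move=> /= An aA.
have le_n : (A a * mabs (val a) <= n)%N.
  by rewrite -An (big_fsetD1 a)//= leq_addr.
have Aa : (0 < A a)%N by rewrite lt0n -mem_finsupp.
by split; apply: leq_trans le_n; [rewrite leq_pmulr// mabs_gt0|rewrite leq_pmull].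
Qed.

Lemma finite_chromatic_partitions q n :
  finite_set (@chromatic_partitions q n).
Proof.
pose S := [set a : multi_pos q | (mabs (val a) <= n)%N].
have finS : finite_set S.
  apply: (@finite_preimage _ _ [set a : multi q | (mabs a <= n)%N] val).
    by move=> a b _ _; apply: val_inj.
  exact: finite_mabs_le.
apply: sub_finite_set (finite_bounded_fsfun (fset_set S) n).
move=> A An /=; split=> [|a].
  apply/fsubsetP => a /(chromatic_partitions_bound _ _ _ _ An)[_ le_a].
  by rewrite in_fset_set// inE.
have [/(chromatic_partitions_bound _ _ _ _ An)[]//|aA] := boolP (a \in finsupp A).
by rewrite fsfun_dflt.
Qed.

(** * The sampling formula and the cycle index *)

(** Both sides are a constant times a product over the support of [A]. The
    constants agree because [nn!] in [multinomial_coef] and [|nn|!] cancel the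
    multinomial coefficient of [nn]; the factors agree because
    [(theta * moment a) ^ A a] may be grouped with either side. *)
Lemma ESF_monom (R : realType) q (q_gt0 : (0 < q)%N) (theta : R)
    (nu : probability (borel_simplex R q_gt0) R) (nn : multi q) t
    (A : chromatic q) :
  ESF theta nu (mabs nn) A * monom t A =
  (mabs nn)`!%:R / rising theta (mabs nn) * multinomial R nn /
    (mabs nn)`!%:R *
  (multinomial_coef R nn A *
     monom (fun a => theta * moment nu (val a) * t a) A).
Proof.
have N0 : (mabs nn)`!%:R != 0 :> R by rewrite pnatr_eq0 -lt0n fact_gt0.
have D0 : (mfact nn)%:R != 0 :> R by rewrite pnatr_eq0 -lt0n mfact_gt0.
rewrite /ESF /monom /multinomial_coef /multinomial.
set c := _ / rising _ _.
have -> : c * ((mabs nn)`!%:R / (mfact nn)%:R) / (mabs nn)`!%:R =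
    c / (mfact nn)%:R by rewrite mulrA mulrAC mulfK.
rewrite -3!mulrA mulKf// -!big_split/=; congr (_ * _).
have factorE (f u m b w s : R) k : f^-1 * (u / m * b * w) ^+ k * s ^+ k =
    b ^+ k / (m ^+ k * f) * (u * w * s) ^+ k.
  rewrite !exprMn exprVn invfM.
  (* With the powers as atoms, both sides are the same monomial. *)
  by move: (u ^+ k) (m ^+ k)^-1 (b ^+ k) (w ^+ k) (s ^+ k) => *; ring.
by apply: eq_bigr => a _; apply: factorE.
Qed.

Lemma sum_ESF_partitions_of (R : realType) q (q_gt0 : (0 < q)%N) (theta : R)
    (nu : probability (borel_simplex R q_gt0) R) (nn : multi q) t :
  \sum_(A \in partitions_of nn) ESF theta nu (mabs nn) A * monom t A =
  (mabs nn)`!%:R / rising theta (mabs nn) * multinomial R nn *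
    cycle_index nn (fun a => theta * moment nu (val a) * t a).
Proof.
rewrite /cycle_index mulrA mulr_fsumr.
by apply: eq_fsbigr => A _; apply: ESF_monom.
Qed.

Theorem proposition4p5 (R : realType) (q : nat) (q_gt0 : (0 < q)%N)
    (theta : R) (theta_gt0 : 0 < theta)
    (nu : probability (borel_simplex R q_gt0) R) :
  (forall (nn : multi q) (t : multi_pos q -> R),
     \sum_(A \in partitions_of nn) ESF theta nu (mabs nn) A * monom t A =
     (mabs nn)`!%:R / rising theta (mabs nn) * multinomial R nn *
       cycle_index nn (fun a => theta * moment nu (val a) * t a)) /\
  (forall (n : nat) (t : multi_pos q -> R),
     \sum_(nn \in [set nn : multi q | mabs nn = n])
        (n`!%:R / rising theta n * multinomial R nn *
         cycle_index nn (fun a => theta * moment nu (val a) * t a)) =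
     \sum_(A \in @chromatic_partitions q n) ESF theta nu n A * monom t A).
Proof.
split=> [nn t|n t]; first exact: sum_ESF_partitions_of.
rewrite (fsbig_fibers (coloring q) _ (finite_chromatic_partitions q n)
  (finite_mabs_eq q n)); last first.
  by move=> _ [A An <-] /=; rewrite mabs_coloring.
apply: eq_fsbigr => nn; rewrite inE /= => <-.
rewrite -sum_ESF_partitions_of; apply: eq_fsbigl.
apply/seteqP; split=> [A /= Ann|A [_ //]].
by split=> //; rewrite /chromatic_partitions /= -mabs_coloring /coloring Ann.
Qed.
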